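(* Let $X$ be a precompact topological abelian group belonging to the class $\mathfrak B$, and let $G:=(c_0(X),\mathfrak u_0)$. Then $j(G^\wedge)=(X^\wedge)^{(\mathbb N)}$. Hence the mapping $\chi:(X^\wedge)^{(\mathbb N)}\to G^\wedge$ is a group isomorphism.
   Context: $\mathbb S=\{s\in\mathbb C:|s|=1\}$. For a topological abelian group $X$, $X^\wedge$ is the group of all continuous homomorphisms $X\to\mathbb S$ under pointwise multiplication (neutral element $1$, the constant character). Precompact means totally bounded. $X^{\mathbb N}$ is the group of all sequences in $X$; $c_0(X)$ is its subgroup of sequences converging to the neutral element $0$. The uniform topology on $X^{\mathbb N}$ is the group topology having $\{V^{\mathbb N}: V \text{ a neighborhood of } 0 \text{ in } X\}$ as a basis of neighborhoods at the neutral element; $\mathfrak u_0$ is the topology it induces on $c_0(X)$. $(X^\wedge)^{(\mathbb N)}$ is the group of sequences $(\xi_n)_{n\in\mathbb N}$ in $X^\wedge$ with $\xi_n=1$ for all but finitely many $n$. For $\mathbf h=(\xi_n)\in (X^\wedge)^{(\mathbb N)}$, $\chi(\mathbf h)=\chi_{\mathbf h}$ is the character $\chi_{\mathbf h}((x_n))=\prod_n\xi_n(x_n)$ of $c_0(X)$ (it belongs to $G^\wedge$). For $n\in\mathbb N$, $\nu_n:X\to c_0(X)$ sends $x$ to the sequence with $x$ in position $n$ and $0$ elsewhere; $j:G^\wedge\to (X^\wedge)^{\mathbb N}$ is the map $j(\kappa)=(\kappa\circ\nu_n)_{n\in\mathbb N}$. $\Gamma_{\mathrm{abs}}(X)$ is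 the set of $\xi\in X^\wedge$ such that for every $(x_n)\in c_0(X)$ the sequence of partial products $\left(\prod_{k=1}^n\xi(x_k)\right)_{n\in\mathbb N}$ converges in $\mathbb S$; it is a subgroup of $X^\wedge$. $\mathfrak B$ is the class of topological abelian groups $X$ with $\Gamma_{\mathrm{abs}}(X)=\{1\}$. *)

(* Defs.v *)
From HB Require Import structures.
From mathcomp Require Import all_boot all_order all_algebra.
From mathcomp Require Import all_classical all_reals all_analysis.
From mathcomp Require Import finmap complex.
Set Implicit Arguments.
Unset Strict Implicit.
Unset Printing Implicit Defensive.
Import Order.TTheory GRing.Theory Num.Theory.
Local Open Scope classical_set_scope.
Local Open Scope ring_scope.
Local Open Scope complex_scope.

(* A topological abelian group is a [topologicalZmodType]; it is written
   additively and no separation axiom is assumed.  Groups of circle-valued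
   functions are written multiplicatively.  Sequences are indexed from 0. *)

Section Circle.
Variable R : realType.

Record circle := Circle { cval : R[i]; _ : `|cval| == 1 }.

HB.instance Definition _ := [isSub for cval].
HB.instance Definition _ := [Choice of circle by <:].

(* [R[i]^o] carries the topology of the modulus. *)
HB.instance Definition _ := Topological.copy circle
  (initial_topology (cval : circle -> R[i]^o)).

Lemma cval_inj : injective cval. Proof. exact: val_inj. Qed.

Lemma cval_norm (s : circle) : `|cval s| = 1.
Proof. exact/eqP/(valP s). Qed.

Lemma cval_neq0 (s : circle) : cval s != 0.
Proof. by rewrite -normr_eq0 cval_norm oner_eq0. Qed.

Lemma cval_continuous : continuous (cval : circle -> R[i]^o).
Proof. exact: initial_continuous. Qed.

Lemma cvg_circle (F : set_system circle) (s : circle) : Filter F ->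
  (cval @ F : set_system R[i]^o) --> (cval s : R[i]^o) -> F --> s.
Proof.
by move=> FF Fs A [_ [[B Bo <-]]] Bs /filterS; apply; apply/Fs/open_nbhs_nbhs.
Qed.

Lemma circle_one_subproof : `|1 : R[i]| == 1.
Proof. by rewrite normr1. Qed.

Lemma circle_mul_subproof (s t : circle) : `|cval s * cval t| == 1.
Proof. by rewrite normrM !cval_norm mulr1. Qed.

Lemma circle_inv_subproof (s : circle) : `|(cval s)^-1| == 1.
Proof. by rewrite normfV cval_norm invr1. Qed.

Definition circle_one : circle := Circle circle_one_subproof.
Definition circle_mul (s t : circle) : circle :=
  Circle (circle_mul_subproof s t).
Definition circle_inv (s : circle) : circle := Circle (circle_inv_subproof s).

Lemma circle_mulA : associative circle_mul.
Proof. by move=> s t u; apply: cval_inj; rewrite /= mulrA. Qed.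

Lemma circle_mulC : commutative circle_mul.
Proof. by move=> s t; apply: cval_inj; rewrite /= mulrC. Qed.

Lemma circle_mul1 : left_id circle_one circle_mul.
Proof. by move=> s; apply: cval_inj; rewrite /= mul1r. Qed.

Lemma circle_mulr1 : right_id circle_one circle_mul.
Proof. by move=> s; rewrite circle_mulC circle_mul1. Qed.

Lemma circle_mulV : left_inverse circle_one circle_inv circle_mul.
Proof. by move=> s; apply: cval_inj; rewrite /= mulVf ?cval_neq0. Qed.

Lemma circle_mulrV : right_inverse circle_one circle_inv circle_mul.
Proof. by move=> s; rewrite circle_mulC circle_mulV. Qed.

HB.instance Definition _ := isGroup.Build circle
  circle_mulA circle_mul1 circle_mulr1 circle_mulV circle_mulrV.
HB.instance Definition _ :=
  SemiGroup.isCommutativeLaw.Build circle *%g circle_mulC.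

Lemma circle_mul_cvg (T : Type) (F : set_system T) (f g : T -> circle) (s t : circle) :
  Filter F -> f @ F --> s -> g @ F --> t ->
  (fun x => (f x * g x)%g) @ F --> (s * t)%g.
Proof.
move=> FF fs gt; apply: cvg_circle.
have fs' : (cval \o f : T -> R[i]^o) @ F --> (cval s : R[i]^o).
  exact: (cvg_comp _ _ fs (@cval_continuous s)).
have gt' : (cval \o g : T -> R[i]^o) @ F --> (cval t : R[i]^o).
  exact: (cvg_comp _ _ gt (@cval_continuous t)).
exact: (@cvgM _ _ F FF (cval \o f : T -> R[i]^o) (cval \o g : T -> R[i]^o) _ _ fs' gt').
Qed.

Lemma circle_inv_cvg (T : Type) (F : set_system T) (f : T -> circle) (s : circle) :
  Filter F -> f @ F --> s -> (fun x => (f x)^-1%g) @ F --> (s^-1)%g.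
Proof.
move=> FF fs; apply: cvg_circle.
have fs' : (cval \o f : T -> R[i]^o) @ F --> (cval s : R[i]^o).
  exact: (cvg_comp _ _ fs (@cval_continuous s)).
exact: (@cvgV _ _ F FF (cval \o f : T -> R[i]^o) _ (cval_neq0 s) fs').
Qed.

End Circle.

Section Dual.
Variables (R : realType) (X : topologicalZmodType).

Record dual := Dual {
  dual_fun :> X -> circle R;
  dual_continuous : continuous dual_fun;
  dualD : {morph dual_fun : x y / x + y >-> (x * y)%g} }.

HB.instance Definition _ := gen_eqMixin dual.
HB.instance Definition _ := gen_choiceMixin dual.

Lemma dual_eq (f g : dual) : f =1 g -> f = g.
Proof.
case: f g => [f cf mf] [g cg mg] /= /funext fg; case: _ / fg in cg mg *.
by congr Dual; exact: Prop_irrelevance.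
Qed.

Lemma dual_one_continuous : continuous (fun _ : X => 1%g : circle R).
Proof. by move=> x; exact: cvg_cst. Qed.

Lemma dual_oneD :
  {morph (fun _ : X => 1%g : circle R) : x y / x + y >-> (x * y)%g}.
Proof. by move=> x y; rewrite mulg1. Qed.

Lemma dual_mul_continuous (f g : dual) : continuous (fun x => (f x * g x)%g).
Proof. by move=> x; apply: circle_mul_cvg; exact: dual_continuous. Qed.

Lemma dual_mulD (f g : dual) :
  {morph (fun x => (f x * g x)%g) : x y / x + y >-> (x * y)%g}.
Proof.
by move=> x y; rewrite !dualD; apply: cval_inj; rewrite /= mulrACA.
Qed.

Lemma dual_inv_continuous (f : dual) : continuous (fun x => (f x)^-1%g).
Proof. by move=> x; apply: circle_inv_cvg; exact: dual_continuous. Qed.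

Lemma dual_invD (f : dual) :
  {morph (fun x => (f x)^-1%g) : x y / x + y >-> (x * y)%g}.
Proof. by move=> x y; rewrite dualD invgM; exact: circle_mulC. Qed.

Definition dual_one : dual := Dual dual_one_continuous dual_oneD.
Definition dual_mul (f g : dual) : dual :=
  Dual (@dual_mul_continuous f g) (@dual_mulD f g).
Definition dual_inv (f : dual) : dual :=
  Dual (@dual_inv_continuous f) (@dual_invD f).

Lemma dual_mulA : associative dual_mul.
Proof. by move=> f g h; apply: dual_eq => x; exact: mulgA. Qed.

Lemma dual_mul1 : left_id dual_one dual_mul.
Proof. by move=> f; apply: dual_eq => x; exact: mul1g. Qed.

Lemma dual_mulr1 : right_id dual_one dual_mul.
Proof. by move=> f; apply: dual_eq => x; exact: mulg1. Qed.

Lemma dual_mulV : left_inverse dual_one dual_inv dual_mul.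
Proof. by move=> f; apply: dual_eq => x; exact: mulVg. Qed.

Lemma dual_mulrV : right_inverse dual_one dual_inv dual_mul.
Proof. by move=> f; apply: dual_eq => x; exact: mulgV. Qed.

HB.instance Definition _ := isGroup.Build dual
  dual_mulA dual_mul1 dual_mulr1 dual_mulV dual_mulrV.

End Dual.

Section UniformSeq.
Variable X : topologicalZmodType.

(* The group X^N with the uniform topology. *)
Definition uniform_seq : Type := nat -> X.

HB.instance Definition _ := GRing.Zmodule.copy uniform_seq (nat -> X).

(* The basic neighborhoods of [a] are the translates [a + V^N]. *)
Definition uniform_seq_nbhs (a : uniform_seq) : set_system uniform_seq :=
  filter_from (nbhs (0 : X)) (fun V => [set b | forall n, V (b n - a n)]).

HB.instance Definition _ := hasNbhs.Build uniform_seq uniform_seq_nbhs.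

Lemma nbhs0_add (V : set X) : nbhs 0 V ->
  exists2 W, nbhs 0 W & forall x y, W x -> W y -> V (x + y).
Proof.
move=> V0; have := @add_continuous X (0, 0) V; rewrite /= addr0 => /(_ V0).
case=> -[A B] /= [A0 B0] ABV; exists (A `&` B); first exact: filterI.
by move=> x y [Ax _] [_ By]; exact: (ABV (x, y)).
Qed.

Lemma nbhs0_opp (V : set X) : nbhs 0 V -> nbhs 0 [set x | V (- x)].
Proof. by move=> V0; have := @opp_continuous X 0 V; rewrite oppr0; exact. Qed.

Lemma uniform_seq_filter (a : uniform_seq) : ProperFilter (nbhs a).
Proof.
apply: filter_from_proper; last first.
  by move=> V V0; exists a => n; rewrite subrr; exact: nbhs_singleton.
apply: filter_from_filter; first by exists setT; exact: filterT.
move=> V W V0 W0; exists (V `&` W); first exact: filterI.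
by move=> b VWb; split=> n; have [] := VWb n.
Qed.

Lemma uniform_seq_nbhs_singleton (a : uniform_seq) (A : set uniform_seq) :
  nbhs a A -> A a.
Proof. by case=> V V0; apply=> n; rewrite subrr; exact: nbhs_singleton. Qed.

Lemma uniform_seq_nbhs_nbhs (a : uniform_seq) (A : set uniform_seq) :
  nbhs a A -> nbhs a (nbhs^~ A).
Proof.
case=> V /nbhs0_add[W W0 WV] VA; exists W => // b Wb.
exists W => // c Wc; apply: VA => n.
by rewrite -(subrK (b n) (c n)) -addrA; exact: WV.
Qed.

HB.instance Definition _ := Nbhs_isNbhsTopological.Build uniform_seq
  uniform_seq_filter uniform_seq_nbhs_singleton uniform_seq_nbhs_nbhs.

Lemma uniform_seq_sub_continuous :
  continuous (fun x : uniform_seq * uniform_seq => x.1 - x.2).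
Proof.
move=> [a b] A [V /nbhs0_add[W W0 WV] VA].
exists ([set c : uniform_seq | forall n, W (c n - a n)],
        [set c : uniform_seq | forall n, W (- (c n - b n))]).
  by split; [exists W|exists [set x | W (- x)] => //; exact: nbhs0_opp].
move=> [c d] /= [Wc Wd]; apply: VA => n /=.
have -> : (c - d) n - (a - b) n = (c n - a n) - (d n - b n).
  by rewrite !fctE /= !opprD !opprK addrACA.
exact: WV.
Qed.

HB.instance Definition _ :=
  PreTopologicalNmodule_isTopologicalZmodule.Build uniform_seq
    uniform_seq_sub_continuous.

End UniformSeq.

Section C0.
Variable X : topologicalZmodType.

Definition cvg0 (x : uniform_seq X) : Prop := (x : nat -> X) @ \oo --> (0 : X).

(* c_0(X) with the topology induced by the uniform one. *)
Record c0 := C0 { c0val : uniform_seq X; _ : `[< cvg0 c0val >] }.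

HB.instance Definition _ := [isSub for c0val].
HB.instance Definition _ := [Choice of c0 by <:].

Lemma c0_cvg (x : c0) : (c0val x : nat -> X) @ \oo --> (0 : X).
Proof. exact/asboolP/(valP x). Qed.

Lemma c0_zmod_closed : zmod_closed (fun x : uniform_seq X => `[< cvg0 x >]).
Proof.
split=> [|x y /asboolP x0 /asboolP y0]; apply/asboolP; first exact: cvg_cst.
have xy : (fun n : nat => (x n, y n)) @ \oo --> (0 : X, 0 : X).
  exact: (cvg_pair x0 y0).
by have := cvg_comp _ _ xy (@sub_continuous X (0, 0)); rewrite /= subr0.
Qed.

HB.instance Definition _ :=
  GRing.SubChoice_isSubZmodule.Build _ _ c0 c0_zmod_closed.
HB.instance Definition _ := Topological.copy c0 (initial_topology c0val).

Lemma c0val_continuous : continuous c0val.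
Proof. exact: initial_continuous. Qed.

Lemma c0_cvg_to (T : Type) (F : set_system T) (f : T -> c0) (a : c0) :
  Filter F -> c0val \o f @ F --> c0val a -> f @ F --> a.
Proof.
by move=> FF Fs A [_ [[B Bo <-]]] Bs /filterS; apply; apply/Fs/open_nbhs_nbhs.
Qed.

Lemma c0_sub_continuous : continuous (fun x : c0 * c0 => x.1 - x.2).
Proof.
move=> [a b].
apply: (@c0_cvg_to _ (nbhs (a, b)) (fun x => x.1 - x.2) (a - b)).
have a' : (fun x : c0 * c0 => c0val x.1) @ (a, b) --> c0val a.
  have fstE : (@fst c0 c0) @ (a, b) --> a by exact: cvg_fst.
  exact: (cvg_comp _ _ fstE (@c0val_continuous a)).
have b' : (fun x : c0 * c0 => c0val x.2) @ (a, b) --> c0val b.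
  have sndE : (@snd c0 c0) @ (a, b) --> b by exact: cvg_snd.
  exact: (cvg_comp _ _ sndE (@c0val_continuous b)).
have ab : (fun x : c0 * c0 => (c0val x.1, c0val x.2)) @ (a, b)
    --> (c0val a, c0val b).
  exact: (cvg_pair a' b').
exact: (cvg_comp _ _ ab (@sub_continuous (uniform_seq X) (c0val a, c0val b))).
Qed.

HB.instance Definition _ :=
  PreTopologicalNmodule_isTopologicalZmodule.Build c0 c0_sub_continuous.

End C0.

Section Maps.
Variables (R : realType) (X : topologicalZmodType).
Local Notation dual := (dual R).

Definition nu_seq (n : nat) (x : X) : uniform_seq X :=
  fun k => if k == n then x else 0.

Lemma nu_cvg0 n x : `[< cvg0 (nu_seq n x) >].
Proof.
apply/asboolP; apply: cvg_near_cst; exists n.+1 => // k /= nk.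
by rewrite /nu_seq gtn_eqF.
Qed.

Definition nu (n : nat) (x : X) : c0 X := C0 (nu_cvg0 n x).

Lemma nuD n : {morph nu n : x y / x + y}.
Proof.
move=> x y; apply: val_inj; apply/funext => k /=.
by rewrite /nu_seq !fctE; case: eqP => // _; rewrite addr0.
Qed.

Lemma nu_continuous n : continuous (nu n).
Proof.
move=> x; apply: c0_cvg_to => A [V V0 VA].
have /= := @sub_continuous X (x, x) V; rewrite /= subrr => /(_ V0).
case=> -[B C] /= [Bx Cx] BCV; apply: filterS Bx => y By.
apply: VA => k /=; rewrite /nu_seq; case: eqP => _.
  by apply: (BCV (y, x)); split => //; exact: nbhs_singleton.
by rewrite subrr; exact: nbhs_singleton.
Qed.

Lemma dual_nu_continuous (kappa : dual (c0 X)) n :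
  continuous (kappa \o nu n).
Proof.
by move=> x; apply: continuous_comp; [exact: nu_continuous|exact: dual_continuous].
Qed.

Lemma dual_nuD (kappa : dual (c0 X)) n :
  {morph kappa \o nu n : x y / x + y >-> (x * y)%g}.
Proof. by move=> x y; rewrite /= nuD dualD. Qed.

Definition jmap (kappa : dual (c0 X)) : nat -> dual X :=
  fun n => Dual (@dual_nu_continuous kappa n) (@dual_nuD kappa n).

Definition fin_supp : set (nat -> dual X) :=
  [set xi | finite_set [set n | xi n <> 1%g]].

(* (X^wedge)^(N) as a group. *)
Record dual_sum := DualSum {
  dual_sum_fun :> nat -> dual X;
  dual_sumP : fin_supp dual_sum_fun }.

HB.instance Definition _ := gen_eqMixin dual_sum.
HB.instance Definition _ := gen_choiceMixin dual_sum.

Lemma dual_sum_eq (f g : dual_sum) : f =1 g -> f = g.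
Proof.
case: f g => [f sf] [g sg] /= /funext fg; case: _ / fg in sg *.
by congr DualSum; exact: Prop_irrelevance.
Qed.

Lemma dual_sum_one_subproof : fin_supp (fun=> 1%g).
Proof. by rewrite /fin_supp /=; apply: sub_finite_set (finite_set0 nat). Qed.

Lemma dual_sum_mul_subproof (f g : dual_sum) :
  fin_supp (fun n => (f n * g n)%g).
Proof.
apply: (@sub_finite_set _ _ ([set n | f n <> 1%g] `|` [set n | g n <> 1%g])).
  move=> n /= fg1; case: (pselect (f n = 1%g)) => [f1|]; last by left.
  by right => g1; apply: fg1; rewrite f1 g1 mulg1.
by rewrite finite_setU; split; exact: dual_sumP.
Qed.

Lemma dual_sum_inv_subproof (f : dual_sum) : fin_supp (fun n => (f n)^-1%g).
Proof.
apply: sub_finite_set (dual_sumP f) => n /= fV1 f1.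
by apply: fV1; rewrite f1 invg1.
Qed.

Definition dual_sum_one : dual_sum := DualSum dual_sum_one_subproof.
Definition dual_sum_mul (f g : dual_sum) : dual_sum :=
  DualSum (dual_sum_mul_subproof f g).
Definition dual_sum_inv (f : dual_sum) : dual_sum :=
  DualSum (dual_sum_inv_subproof f).

Lemma dual_sum_mulA : associative dual_sum_mul.
Proof. by move=> f g h; apply: dual_sum_eq => n; exact: mulgA. Qed.

Lemma dual_sum_mul1 : left_id dual_sum_one dual_sum_mul.
Proof. by move=> f; apply: dual_sum_eq => n; exact: mul1g. Qed.

Lemma dual_sum_mulr1 : right_id dual_sum_one dual_sum_mul.
Proof. by move=> f; apply: dual_sum_eq => n; exact: mulg1. Qed.

Lemma dual_sum_mulV : left_inverse dual_sum_one dual_sum_inv dual_sum_mul.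
Proof. by move=> f; apply: dual_sum_eq => n; exact: mulVg. Qed.

Lemma dual_sum_mulrV : right_inverse dual_sum_one dual_sum_inv dual_sum_mul.
Proof. by move=> f; apply: dual_sum_eq => n; exact: mulgV. Qed.

HB.instance Definition _ := isGroup.Build dual_sum
  dual_sum_mulA dual_sum_mul1 dual_sum_mulr1 dual_sum_mulV dual_sum_mulrV.

(* The product over all n, which has finitely many factors other than 1. *)
Definition chi_fun (h : dual_sum) (x : c0 X) : circle R :=
  (\big[*%g/1%g]_(n \in [set: nat]) h n (c0val x n)).

Lemma chi_funE (h : dual_sum) (x : c0 X) :
  chi_fun h x =
    (\prod_(n <- fset_set [set n | h n <> 1%g]) h n (c0val x n))%g.
Proof.
rewrite /chi_fun (fsbigTE (fset_set [set n | h n <> 1%g]))// => n.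
rewrite in_fset_set ?notin_setE; last exact: dual_sumP.
by move=> /contrapT ->.
Qed.

Lemma coord_continuous n : continuous (fun x : c0 X => c0val x n).
Proof.
move=> x V Vx.
have V0 : nbhs (0 : X) [set y | V (y + c0val x n)].
  have /= := @add_continuous X (0, c0val x n) V; rewrite /= add0r => /(_ Vx).
  case=> -[B C] /= [B0 Cx] BCV; apply: filterS B0 => y By.
  by apply: (BCV (y, c0val x n)); split => //; exact: nbhs_singleton.
have := @c0val_continuous X x [set y : uniform_seq X | V (y n)].
apply; exists [set y | V (y + c0val x n)] => // y /(_ n) /=.
by rewrite subrK.
Qed.

Lemma chi_continuous (h : dual_sum) : continuous (chi_fun h).
Proof.
rewrite (funext (chi_funE h)) => x.
elim: (enum_fset _) => [|n s IHs].
  have -> : (fun y : c0 X => \prod_(k <- [::]) h k (c0val y k))%g = fun=> 1%g.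
    by apply/funext => y; rewrite big_nil.
  exact: cst_continuous.
have -> : (fun y : c0 X => \prod_(k <- n :: s) h k (c0val y k))%g =
    (fun y => h n (c0val y n) * \prod_(k <- s) h k (c0val y k))%g.
  by apply/funext => y; rewrite big_cons.
apply: circle_mul_cvg IHs.
exact: (@continuous_comp _ _ _ (fun y : c0 X => c0val y n) (h n) x
  (@coord_continuous n x) (@dual_continuous _ _ (h n) _)).
Qed.

Lemma chi_funD (h : dual_sum) :
  {morph chi_fun h : x y / x + y >-> (x * y)%g}.
Proof.
move=> x y; rewrite !chi_funE -big_split/=.
by apply: eq_bigr => n _; exact: dualD.
Qed.

Definition chi (h : dual_sum) : dual (c0 X) :=
  Dual (@chi_continuous h) (@chi_funD h).

Definition Gamma_abs : set (dual X) :=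
  [set xi : dual X | forall x : c0 X, exists s : circle R,
    (fun n => \prod_(k < n.+1) xi (c0val x k))%g @ \oo --> s].

Definition class_B : Prop := Gamma_abs = [set 1%g].

End Maps.

Definition totally_bounded (X : topologicalZmodType) : Prop :=
  forall V : set X, nbhs 0 V ->
    exists2 F : set X, finite_set F & forall x, exists2 y, F y & V (x - y).

Definition group_isomorphism (G H : groupType) (f : G -> H) : Prop :=
  {morph f : x y / (x * y)%g} /\ bijective f.

(* Main.v *)
(* Let kappa be a character of c_0(X) and xi_n its n-th coordinate.  Continuity
   of kappa for the uniform topology makes the family (xi_n) equicontinuous; as
   X is precompact and the circle has no small subgroups, such a family takes
   only finitely many values.  If infinitely many xi_n were nontrivial, some
   xi <> 1 would equal xi_n for infinitely many n; placing the terms of a null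
   sequence (x_k) at these positions gives a point of c_0(X) whose truncations
   converge to it, so that the products of the xi(x_k) converge: xi would lie
   in Gamma_abs(X) = {1}.  Density of the finitely supported sequences makes j
   injective, and chi is its inverse. *)
Require Import Defs.
From mathcomp Require Import all_boot all_order all_algebra.
From mathcomp Require Import all_classical all_reals all_analysis.
From mathcomp Require Import finmap complex ring lra.
Set Implicit Arguments.
Unset Strict Implicit.
Unset Printing Implicit Defensive.
Import Order.TTheory GRing.Theory Num.Theory.
Local Open Scope classical_set_scope.
Local Open Scope ring_scope.

(** * Metric geometry of the circle *)

Section Circle.
Variable R : realType.
Implicit Types s t : circle R.

Lemma circle_cvg_unique (T : Type) (F : set_system T) (f : T -> circle R) s t :
  ProperFilter F -> f @ F --> s -> f @ F --> t -> s = t.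
Proof.
move=> FF fs ft; apply: cval_inj.
have cvgc u : f @ F --> u -> (@cval R \o f : T -> R[i]^o) @ F --> (cval u : R[i]^o).
  by move=> fu; exact: (cvg_comp _ _ fu (@cval_continuous R u)).
exact: (cvg_unique (@norm_hausdorff _ (R[i]^o)) (cvgc s fs) (cvgc t ft)).
Qed.

(** The norm on [R[i]] is itself [R[i]]-valued; its real part turns estimates into inequalities in
    the ordered field [R]. *)
Definition circle_dist s t : R := complex.Re `|cval s - cval t|.

Lemma circle_distE s t : `|cval s - cval t| = (circle_dist s t)%:C%C.
Proof.
by rewrite /circle_dist -[LHS]RRe_real// ger0_real// normr_ge0.
Qed.

Lemma circle_dist_ge0 s t : 0 <= circle_dist s t.
Proof. by rewrite -lecR -circle_distE; exact: normr_ge0. Qed.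

Lemma circle_distC s t : circle_dist s t = circle_dist t s.
Proof. by rewrite /circle_dist distrC. Qed.

Lemma circle_dist_eq0 s t : circle_dist s t = 0 -> s = t.
Proof.
move=> d0; apply: cval_inj; apply/eqP; rewrite -subr_eq0 -normr_eq0.
by rewrite circle_distE d0.
Qed.

Lemma circle_distD u s t : circle_dist s t <= circle_dist s u + circle_dist u t.
Proof.
by rewrite -lecR rmorphD /= -!circle_distE ler_distD.
Qed.

Lemma cval1 : cval (1%g : circle R) = 1. Proof. by []. Qed.

Lemma cvalM s t : cval (s * t)%g = cval s * cval t. Proof. by []. Qed.

Lemma circle_distM u s t : circle_dist (u * s)%g (u * t)%g = circle_dist s t.
Proof. by rewrite /circle_dist !cvalM -mulrBr normrM cval_norm mul1r. Qed.

Lemma circle_distMM s t u v :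
  circle_dist (s * t)%g (u * v)%g <= circle_dist s u + circle_dist t v.
Proof.
rewrite (le_trans (circle_distD (u * t)%g _ _))// lerD// ?circle_distM//.
by rewrite [(s * t)%g]circle_mulC [(u * t)%g]circle_mulC circle_distM.
Qed.

(** Factor [s^2 - 1 = (s + 1)(s - 1)]; under the hypothesis [s + 1] has modulus at least
    [2 - 1/2]. *)
Lemma circle_dist_sqr s : circle_dist s 1%g <= 2^-1 ->
  3 / 2 * circle_dist s 1%g <= circle_dist (s * s)%g 1%g.
Proof.
move=> s1; rewrite -lecR rmorphM /= -!circle_distE cvalM cval1.
have -> : cval s * cval s - 1 = (cval s + 1) * (cval s - 1).
  by rewrite [RHS]mulrC -subr_sqr expr1n expr2.
rewrite normrM ler_wpM2r//.
have -> : cval s + 1 = 2 - (1 - cval s).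
  by ring.
rewrite (le_trans _ (lerB_dist _ _))// distrC.
have -> : `|cval s - 1| = (circle_dist s 1%g)%:C%C by rewrite -circle_distE cval1.
rewrite normr_nat -[2 in leRHS](rmorph_nat (@real_complex R)) -rmorphB lecR; lra.
Qed.

Lemma circle_mesh : exists (I : finType) (c : circle R -> I),
  forall s t, c s = c t -> circle_dist s t <= 4^-1.
Proof.
exists ('I_17 * 'I_17)%type.
(* A coordinate in [[-1, 1]] is scaled to [[0, 16]], endpoints included, so its integer part takes
   17 values. Within a cell each coordinate varies by at most 1/8, and [sqrt 2 / 8 <= 1/4]. *)
pose g (x : R) : 'I_17 := inord (Num.truncn ((x + 1) * 8)).
have gP x y : `|x| <= 1 -> `|y| <= 1 -> g x = g y -> `|x - y| <= 8^-1.
  move=> x1 y1 /(congr1 val).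
  have bd (z : R) : `|z| <= 1 ->
      [/\ val (g z) = Num.truncn ((z + 1) * 8) &
         (Num.truncn ((z + 1) * 8))%:R <= (z + 1) * 8
          < (Num.truncn ((z + 1) * 8)).+1%:R].
    rewrite ler_norml => /andP[z1 z2].
    have z0 : 0 <= (z + 1) * 8 by lra.
    have z16 : (z + 1) * 8 <= 16 by lra.
    have zi := truncn_itv z0; split=> //.
    rewrite /= inordK// ltnS -(ler_nat R); exact: le_trans (andP zi).1 z16.
  have [-> /andP[a1 a2]] := bd x x1; have [-> /andP[b1 b2]] := bd y y1.
  move=> e; rewrite e in a1 a2; rewrite ler_norml.
  move: (Num.truncn _) a1 a2 b1 b2 => k; rewrite -[k.+1%:R]natr1 => a1 a2 b1 b2.
  by apply/andP; split; lra.
exists (fun s => (g (complex.Re (cval s)), g (complex.Im (cval s)))).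
move=> s t [eRe eIm].
have sub1 (z : R[i]) : `|z| = 1 -> `|complex.Re z| <= 1 /\ `|complex.Im z| <= 1.
  case: z => a b; rewrite normc_def => /(congr1 (@complex.Re R)) /= n1.
  have ab : a ^+ 2 + b ^+ 2 = 1.
    by rewrite -[LHS]sqr_sqrtr ?n1 ?expr1n// addr_ge0 ?sqr_ge0.
  by split; rewrite -(@ler_sqr _ _ 1) ?nnegrE// real_normK ?num_real// expr1n
    -ab ?lerDl ?lerDr sqr_ge0.
have [sR sI] := sub1 _ (cval_norm s); have [tR tI] := sub1 _ (cval_norm t).
have := gP _ _ sR tR eRe; have := gP _ _ sI tI eIm.
move=> bd ac; rewrite -lecR -circle_distE.
case: (cval s) (cval t) bd ac => [a b] [c d] /= bd ac.
rewrite normc_def lecR /= -(@ger0_norm _ 4^-1)// -sqrtr_sqr ler_wsqrtr//.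
move: bd ac; rewrite -(real_normK (num_real (a - c))) -(real_normK (num_real (b - d))).
move: (normr_ge0 (a - c)) (normr_ge0 (b - d)) => *; nra.
Qed.

End Circle.

(** * Characters and their equicontinuous families *)

Section Characters.
Variables (R : realType) (X : topologicalZmodType).
Implicit Types xi : dual R X.

Lemma dual0 xi : xi 0 = 1%g.
Proof. by apply: (mulgI (xi 0)); rewrite -dualD addr0 mulg1. Qed.

Lemma dual_big xi (I : Type) (r : seq I) (F : I -> X) :
  xi (\sum_(i <- r) F i) = (\prod_(i <- r) xi (F i))%g.
Proof. exact: (big_morph xi (dualD xi) (dual0 xi)). Qed.

(** Each doubling of the argument stretches the distance to 1 by a factor of at least 3/2, so a
    nonzero distance would eventually leave the ball. *)
Lemma no_small_subgroup xi :
  (forall x, circle_dist (xi x) 1%g <= 2^-1) -> xi = 1%g.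
Proof.
move=> small; apply: dual_eq => x; apply: circle_dist_eq0.
(* The linear bound [1 + n/2 <= (3/2)^n] is enough for the Archimedean argument below. *)
have grow n y : (1 + n%:R / 2) * circle_dist (xi y) 1%g <= 2^-1.
  elim: n y => [|n IHn] y; first by rewrite mul0r addr0 mul1r.
  have := circle_dist_sqr (small y); rewrite -dualD => dyy.
  have := IHn (y + y); rewrite -[n.+1%:R]natr1.
  have n0 : 0 <= n%:R :> R by [].
  have := circle_dist_ge0 (xi y) 1%g.
  set a := circle_dist (xi y) _ in dyy *.
  set b := circle_dist (xi (y + y)) _ in dyy *.
  move=> a0; apply: le_trans; nra.
apply/eqP; rewrite eq_le circle_dist_ge0 andbT leNgt; apply/negP => d0.
set d := circle_dist (xi x) 1%g in d0.
have := grow (Num.truncn d^-1).+1 x; rewrite -/d leNgt => /negP; apply.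
have := truncnS_gt d^-1; rewrite -(ltr_pM2r d0) mulVf ?gt_eqF//; lra.
Qed.

Lemma dual_ball xi (e : R) : 0 < e ->
  nbhs 0 [set x | circle_dist (xi x) 1%g <= e].
Proof.
move=> e0.
have xi1 : (@cval R \o xi : X -> R[i]^o) @ 0 --> (1 : R[i]^o).
  rewrite -[1 in X in _ --> X]/(cval (1%g : circle R)) -(dual0 xi).
  exact: (cvg_comp _ _ (@dual_continuous _ _ xi 0) (@cval_continuous R (xi 0))).
have e0' : 0 < e%:C%C by rewrite ltcR.
have := @cvgr_dist_le _ _ _ _ (nbhs_filter (0 : X)) _ _ xi1 _ e0'.
apply: filterS => x /=; rewrite circle_distC -lecR -circle_distE; exact.
Qed.

(* Pigeonhole: the values of [u n] on a finite net are coloured by a finite mesh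
   of the circle; [u n] and [u m] with the same colours are uniformly so close
   that [u n / u m] takes values in a ball containing no nontrivial subgroup. *)
Lemma precompact_equicontinuous_repeats (u : nat -> dual R X) (S : set nat)
    (V : set X) :
  totally_bounded X -> nbhs 0 V ->
  (forall n x, V x -> circle_dist (u n x) 1%g <= 16^-1) ->
  infinite_set S -> exists2 n, S n & infinite_set [set m | u m = u n].
Proof.
move=> tbX V0 uV Sinf; have [F finF FV] := tbX V V0.
have [I [c cP]] := circle_mesh R.
pose A := fset_set F.
pose col n : {ffun A -> I} := [ffun y => c (u n (\val y))].
have colP n m : col n = col m -> u n = u m.
  move=> nm; suff /(congr1 (fun g => g * u m)%g) : (u n * (u m)^-1)%g = 1%g.
    by rewrite mulgVK mul1g.
  apply: no_small_subgroup => x.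
  have [y Fy Vxy] := FV x.
  have Ay : y \in A by rewrite in_fset_set//; exact: mem_set.
  have dy : circle_dist (u n y) (u m y) <= 4^-1.
    apply: cP.
    by have := congr1 (fun g : {ffun A -> I} => g [` Ay]%fset) nm; rewrite !ffunE.
  have dv : circle_dist (u n (x - y)) (u m (x - y)) <= 16^-1 + 16^-1.
    rewrite (le_trans (circle_distD 1%g _ _))// lerD ?uV//.
    by rewrite circle_distC uV.
  have -> : circle_dist ((u n * (u m)^-1)%g x) 1%g = circle_dist (u n x) (u m x).
    rewrite -(circle_distM (u m x)) mulg1; congr (circle_dist _ _).
    by apply: cval_inj; rewrite /= mulrCA mulfV ?cval_neq0// mulr1.
  rewrite -(subrK y x) !(dualD _ (x - y)).
  (* The total is [1/16 + 1/16 + 1/4 = 3/8], below the required 1/2. *)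
  by apply: (le_trans (circle_distMM _ _ _ _)); lra.
apply: contrapT => noinf; apply: Sinf.
(* A colour class lies in a fibre of [u]; if all fibres meeting [S] were finite, [S] would be a
   finite union of finite sets. *)
apply: (@sub_finite_set _ _ (\bigcup_(g in [set: {ffun A -> I}])
    [set m | S m /\ col m = g])).
  by move=> m Sm; exists (col m).
apply: bigcup_finite => [|g _]; first exact: finite_finset.
have [[n [Sn <-]]|nex] := pselect (exists n, S n /\ col n = g).
  apply: contrapT => inf; apply: noinf; exists n => // fin; apply: inf.
  by apply: sub_finite_set fin => m [_ /colP].
by apply: (@sub_finite_set _ _ set0) => // m [Sm ?]; apply: nex; exists m.
Qed.

End Characters.

(** * Characters of [c0 X] and their coordinates *)

Section C0Dual.
Variables (R : realType) (X : topologicalZmodType).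
Implicit Types (kappa : dual R (c0 X)) (x : c0 X).

Lemma nbhs0_c0 (U : set (c0 X)) : nbhs 0 U -> exists2 V : set X, nbhs 0 V &
  forall x, (forall n, V (c0val x n)) -> U x.
Proof.
case=> _ [[B Bo <-]] /= B0 BU.
have [V V0 VB] : nbhs (0 : uniform_seq X) B by exact: open_nbhs_nbhs.
by exists V => // x xV; apply/BU/VB => n; rewrite subr0.
Qed.

Definition c0_trunc x m : c0 X := \sum_(k < m) nu k (c0val x k).

Lemma c0_truncE x m n : c0val (c0_trunc x m) n = if (n < m)%N then c0val x n else 0.
Proof.
rewrite /c0_trunc; elim: m => [|m IHm]; first by rewrite big_ord0.
rewrite big_ord_recr /=.
transitivity (c0val (\sum_(k < m) nu k (c0val x k)) n + nu_seq m (c0val x m) n) => //.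
rewrite IHm /nu_seq ltnS (leq_eqVlt n).
by case: ltngtP => [||->]; rewrite ?addr0 ?add0r.
Qed.

(** The error is, up to sign, a tail of [x]; as [x] is null, one index puts all entries of the tail
    in a given neighborhood. *)
Lemma c0_trunc_cvg x : c0_trunc x @ \oo --> x.
Proof.
apply: c0_cvg_to => A [V V0 VA].
have [M _ MV] := c0_cvg x (nbhs0_opp V0).
exists M => // m /= Mm; apply: VA => n; rewrite c0_truncE; case: ltnP => [_|mn].
  by rewrite subrr; exact: nbhs_singleton.
by rewrite sub0r; apply: MV => /=; exact: leq_trans mn.
Qed.

(** The partial products are the values of [kappa] at the truncations of [x]. *)
Lemma jmap_cvg kappa x :
  (fun m => \prod_(k < m) jmap kappa k (c0val x k))%g @ \oo --> kappa x.
Proof.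
have := cvg_comp _ _ (c0_trunc_cvg (x := x)) (@dual_continuous _ _ kappa x).
by under [X in X @ _ --> _ -> _]funext => m do rewrite /= dual_big.
Qed.

Lemma jmap_inj : injective (@jmap R X).
Proof.
move=> f g fg; apply: dual_eq => x.
have fx := jmap_cvg (kappa := f) (x := x); rewrite fg in fx.
exact: (circle_cvg_unique _ fx (jmap_cvg (kappa := g) (x := x))).
Qed.

Lemma jmapM (f g : dual R (c0 X)) :
  jmap (f * g)%g = (fun n => jmap f n * jmap g n)%g.
Proof. by apply/funext => n; apply: dual_eq. Qed.

Lemma jmap_chi (h : dual_sum R X) : jmap (chi h) = h.
Proof.
apply/funext => n; apply: dual_eq => x /=.
rewrite /chi_fun (fsbigTE [fset n]%fset) => [|k].
  by rewrite big_seq_fset1 /= /nu_seq eqxx.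
by rewrite !inE /= /nu_seq => /negPf ->; rewrite dual0.
Qed.

(** A basic uniform neighborhood constrains all positions by the same [V], so it contains [nu n y]
    for every [n] once [y] is in [V]. *)
Lemma jmap_equicontinuous kappa (e : R) : 0 < e -> exists2 V : set X, nbhs 0 V &
  forall n y, V y -> circle_dist (jmap kappa n y) 1%g <= e.
Proof.
move=> /(dual_ball kappa)/nbhs0_c0[V V0 VP]; exists V => // n y Vy.
apply: VP => k /=; rewrite /nu_seq; case: eqP => // _.
exact: nbhs_singleton.
Qed.

End C0Dual.

(** * Spreading a null sequence over infinitely many positions *)

Section Spread.
Variable (X : topologicalZmodType) (p : pred nat).
Hypothesis pinf : infinite_set [set n | p n].

(** Counts the selected positions strictly below [n]. *)
Definition rank n := \sum_(k < n) (p k : nat).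

Lemma rankS n : rank n.+1 = (rank n + p n)%N.
Proof. by rewrite /rank big_ord_recr. Qed.

Lemma rank_homo : {homo rank : m n / (m <= n)%N}.
Proof.
by apply: homo_leq => [//|m n k|n]; [exact: leq_trans|rewrite rankS leq_addr].
Qed.

Lemma rank_unbounded i : exists n, (i <= rank n)%N.
Proof.
elim: i => [|i [n iN]]; first by exists 0%N.
have [m nm pm] : exists2 m, (n <= m)%N & p m.
  apply: contrapT => nop; apply: pinf.
  apply: (sub_finite_set _ (finite_II n)) => m /= pm.
  by rewrite ltnNge; apply/negP => nm; apply: nop; exists m.
exists m.+1; rewrite rankS pm addn1 ltnS (leq_trans iN)//; exact: rank_homo.
Qed.

(** A discrete intermediate value argument: [rank] is unbounded and rises by at most 1 at each
    step. *)
Lemma rank_surj m i : (rank m <= i)%N -> exists2 n, (m <= n)%N & rank n = i.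
Proof.
move=> mi; have [n ni] := rank_unbounded i.
have : (i <= rank (m + n))%N by rewrite (leq_trans ni)// rank_homo// leq_addl.
elim: n {ni} => [|n IHn].
  by rewrite addn0 => im; exists m => //; apply/eqP; rewrite eqn_leq mi.
have [/IHn //|ni] := leqP i (rank (m + n)).
rewrite addnS rankS => iSn; exists (m + n).+1; first by rewrite -addnS leq_addr.
apply/eqP; rewrite rankS eqn_leq iSn andbT.
by case: (p _); rewrite ?addn1 ?addn0// ltnW.
Qed.

(* The terms of [x] are put, in order, at the positions selected by [p]. *)
Definition spread_seq (x : c0 X) : uniform_seq X :=
  fun n => if p n then c0val x (rank n) else 0.

Lemma spread_cvg0 x : `[< cvg0 (spread_seq x) >].
Proof.
apply/asboolP => V V0; have [M _ MV] := c0_cvg x V0.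
have [N MN] := rank_unbounded M; exists N => // n /= Nn.
rewrite /spread_seq; case: ifP => _; last exact: nbhs_singleton.
by apply: MV => /=; rewrite (leq_trans MN)// rank_homo.
Qed.

Definition spread x : c0 X := C0 (spread_cvg0 x).

Lemma prod_spread (R : realType) (u : nat -> dual R X) (xi : dual R X) x m :
  (forall n, p n -> u n = xi) ->
  (\prod_(k < m) u k (c0val (spread x) k) =
   \prod_(k < rank m) xi (c0val x k))%g.
Proof.
move=> uxi; elim: m => [|m IHm]; first by rewrite /rank !big_ord0.
rewrite big_ord_recr IHm rankS /= /spread_seq.
case: ifP => pm; last by rewrite addn0 dual0 mulg1.
by rewrite addn1 big_ord_recr uxi.
Qed.

(** Repeating terms loses nothing: by [rank_surj] every index from [rank M] on is the rank of some
    [n >= M]. *)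
Lemma cvg_rank (T : topologicalType) (v : nat -> T) (l : T) :
  v \o rank @ \oo --> l -> v @ \oo --> l.
Proof.
move=> vl A /vl[M _ MA]; exists (rank M) => // i /= Mi.
by have [n Mn <-] := rank_surj Mi; exact: MA.
Qed.

End Spread.

(** * Finite support of the coordinates *)

Section Finiteness.
Variables (R : realType) (X : topologicalZmodType).

Lemma Gamma_abs_repeated (kappa : dual R (c0 X)) (xi : dual R X) :
  infinite_set [set n | jmap kappa n = xi] -> Gamma_abs xi.
Proof.
move=> xiinf x; pose p n := `[< jmap kappa n = xi >].
have pinf : infinite_set [set n | p n].
  by apply: contra_not xiinf; apply: sub_finite_set => n /= /asboolP.
exists (kappa (spread pinf x)).
have xi_cvg : (fun m => \prod_(k < m) xi (c0val x k))%g @ \oo -->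
    kappa (spread pinf x).
  apply: (cvg_rank pinf).
  have := jmap_cvg (kappa := kappa) (x := spread pinf x).
  under [X in X @ _ --> _ -> _]funext => m.
    rewrite (@prod_spread _ _ pinf _ _ xi).
      over.
    by move=> n /asboolP.
  exact.
(* [Gamma_abs] takes [n.+1] factors at index [n], hence a shift by one. *)
by apply: (cvg_comp _ _ _ xi_cvg) => A [N _ NA]; exists N => // n /= Nn;
  apply: NA; exact: leqW.
Qed.

Lemma fin_supp_jmap (kappa : dual R (c0 X)) :
  totally_bounded X -> class_B R X -> fin_supp (jmap kappa).
Proof.
move=> tbX BX; apply: contrapT => inf.
have e0 : 0 < 16^-1 :> R by [].
have [V V0 kV] := jmap_equicontinuous kappa e0.
(* Here [S] is the set of indices with nontrivial coordinate, infinite by [inf]. *)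
have [n n1 ninf] := precompact_equicontinuous_repeats tbX V0 kV inf.
apply: n1; have := Gamma_abs_repeated ninf.
by rewrite BX.
Qed.

End Finiteness.

Theorem theorem6p3 (R : realType) (X : topologicalZmodType)
    (precompactX : totally_bounded X) (BX : class_B R X) :
  range (@jmap R X) = @fin_supp R X /\
  group_isomorphism (@chi R X : dual_sum R X -> dual R (c0 X)).
Proof.
have finj kappa := fin_supp_jmap kappa precompactX BX.
split.
  apply/seteqP; split=> [_ [kappa _ <-]|h fh]; first exact: finj.
  by exists (chi (DualSum fh)) => //; exact: (jmap_chi (DualSum fh)).
split.
  (* As [jmap] is injective and undoes [chi], identities between characters are checked on
     coordinates. *)
  by move=> g h; apply: jmap_inj; rewrite jmapM !jmap_chi.
exists (fun kappa => DualSum (finj kappa)) => [h|kappa].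
  by apply: dual_sum_eq => n /=; rewrite jmap_chi.
by apply: jmap_inj; rewrite jmap_chi.
Qed.
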